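(* Let $\beta\in(0,1)$, $\beta\approx0.7541996008265638$, be the solution of $$\sin(2\pi\beta)-\sin(\pi\beta)=\beta\pi\cos(\pi\beta),$$ and let $$\Gamma(x)=\begin{cases}\beta-x,&x\in[0,\beta),\\ x,&x\in[\beta,1].\end{cases}$$ Then, for $U$ uniformly distributed on $[0,1]$, the distribution of the vector $(U,\Gamma(U))$ maximizes $$\int_{[0,1]^2}\sin(\pi(x+y))\,dC(x,y)$$ in the set of all bivariate distributions $C$ with uniform marginals on $[0,1]$, i.e., in the set of all copulas.
   Context: A copula is the joint distribution function on $[0,1]^2$ of a random vector whose two components are each uniformly distributed on $[0,1]$; the integral $\int F\,dC$ is the integral of $F$ against the corresponding probability measure on $[0,1]^2$. *)

(* Defs.v *)
From HB Require Import structures.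
From mathcomp Require Import all_boot all_order all_algebra.
From mathcomp Require Import all_classical all_reals all_analysis.
From mathcomp Require Import measurable_realfun.

Set Implicit Arguments.
Unset Strict Implicit.
Unset Printing Implicit Defensive.

Import Order.TTheory GRing.Theory Num.Theory.
Import numFieldNormedType.Exports.

Local Open Scope classical_set_scope.
Local Open Scope ring_scope.

Section copulas.
Context {R : realType}.

(* Agreement is required on Borel sets only: off the sigma-algebra the values
   of set functions carry no meaning. *)
Definition uniform01 (mu : set R -> \bar R) : Prop :=
  forall A, measurable A -> mu A = uniform_prob (@ltr01 R) A.

(* A copula is identified with the probability measure of which it is the
   joint distribution function.  Uniformity of the marginals forces this measure
   on R * R to be concentrated on the unit square. *)
Definition copula : set (probability (R * R)%type R) :=
  [set C | uniform01 (pushforward C fst) /\ uniform01 (pushforward C snd)].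

Definition unit_square : set (R * R) := `[0, 1] `*` `[0, 1].

Definition sin_integral (C : probability (R * R)%type R) : \bar R :=
  (\int[C]_(p in unit_square) (sin (pi * (p.1 + p.2)))%:E)%E.

Definition maximizes {T : Type} (J : T -> \bar R) (S : set T) (m : T) : Prop :=
  S m /\ forall m', S m' -> (J m' <= J m)%E.

Definition beta_equation (beta : R) : Prop :=
  0 < beta < 1 /\
  sin (2 * pi * beta) - sin (pi * beta) = beta * pi * cos (pi * beta).

(* The decimal 0.7541996008265638, in groups of three digits.  The solution is
   0.75419960082656366..., so the last digit is only accurate to two units. *)
Definition beta_approx : R :=
  754 / 10 ^+ 3 + 199 / 10 ^+ 6 + 600 / 10 ^+ 9 + 826 / 10 ^+ 12 +
  563 / 10 ^+ 15 + 8 / 10 ^+ 16.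

(* Only the values on [0, 1] matter; the two branches are extended to R. *)
Definition Gamma (beta x : R) : R := if x < beta then beta - x else x.

Lemma measurable_Gamma (beta : R) : measurable_fun setT (Gamma beta).
Proof.
apply: measurable_fun_ifT => //.
- exact: measurable_fun_ltr.
- exact: measurable_funB.
Qed.

Section graph.
Context d (T : measurableType d).

Definition Gamma_pair (beta : R) (U : {mfun T >-> R}) (t : T) : R * R :=
  (U t, Gamma beta (U t)).

Lemma measurable_Gamma_pair (beta : R) (U : {mfun T >-> R}) :
  measurable_fun setT (Gamma_pair beta U).
Proof.
apply: measurable_fun_pair => //.
by apply: (measurableT_comp (measurable_Gamma beta)).
Qed.

HB.instance Definition _ (beta : R) (U : {mfun T >-> R}) :=
  isMeasurableFun.Build _ _ _ _ (Gamma_pair beta U)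
    (measurable_Gamma_pair beta U).

End graph.

End copulas.

(* Main.v *)
(* Kantorovich duality.  Put b = pi beta and define on [0, pi] the potential
     f t = cos b (t - b / 2) + sin b / 2  if t < b,
     f t = sin (2 t) / 2                  if b <= t.
   It satisfies sin (s + t) <= f s + f t, with equality when s = pi x and
   t = pi (Gamma x).  Since the integral of f (pi x) + f (pi y) against a copula
   depends on the marginals only, it bounds the integral of sin (pi (x + y)) for
   every copula and equals it for the law of (U, Gamma U), which is a copula
   because a reflection of [0, beta) preserves Lebesgue measure.  The two pieces
   of f agree at b exactly when sin (2 b) - sin b = b cos b.

   For the root itself: sin (2 t) - sin t - t cos t does not vanish on (0, pi)
   where cos t >= -1/2 and is increasing where cos t < -1/2, so there is at most
   one root; signs at two rationals 2e-18 apart, decided by alternating Taylor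
   bounds evaluated in exact integer arithmetic, locate it. *)

Require Import Defs.
From Stdlib Require Import ZArith.
From HB Require Import structures.
From mathcomp Require Import all_boot all_order all_algebra.
From mathcomp Require Import all_classical all_reals all_analysis.
From mathcomp Require Import measurable_realfun.
From mathcomp Require Import ring lra zify ssrZ.

Set Implicit Arguments.
Unset Strict Implicit.
Unset Printing Implicit Defensive.

Import Order.TTheory GRing.Theory Num.Theory.
Import numFieldNormedType.Exports.

(* MathComp rebinds the scope key Z to its own integers. *)
Delimit Scope Z_scope with BZ.

Local Open Scope classical_set_scope.
Local Open Scope ring_scope.

(** * Monotonicity from the sign of a derivative *)

Lemma is_derive_nondecreasing (R : realType) (f f' : R -> R) (a b : R) :
  (forall x : R, is_derive x 1 f (f' x)) ->
  (forall x, a < x < b -> 0 <= f' x) -> a <= b -> f a <= f b.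
Proof.
move=> df f'0 ab; rewrite -subr_ge0; move: ab.
rewrite le_eqVlt => /predU1P[->|ab].
  by rewrite subrr.
have cf : {within `[a, b], continuous f}.
  apply: derivable_within_continuous => x _.
  by have [] := df x.
have [c cab ->] := MVT ab (fun x _ => df x) cf.
rewrite mulr_ge0 ?subr_ge0 1?(ltW ab)//; apply: f'0.
by move: cab; rewrite in_itv.
Qed.

Lemma is_derive_increasing (R : realType) (f f' : R -> R) (a b : R) :
  (forall x : R, is_derive x 1 f (f' x)) ->
  (forall x, a < x < b -> 0 < f' x) -> a < b -> f a < f b.
Proof.
move=> df f'0 ab; rewrite -subr_gt0.
have cf : {within `[a, b], continuous f}.
  apply: derivable_within_continuous => x _.
  by have [] := df x.
have [c cab ->] := MVT ab (fun x _ => df x) cf.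
rewrite mulr_gt0 ?subr_gt0//; apply: f'0.
by move: cab; rewrite in_itv.
Qed.

(** * Alternating Taylor bounds for sine and cosine *)

Section taylor.
Context {R : realType}.
Implicit Types x : R.

Definition sin_taylor m x : R :=
  \sum_(k < m) (-1) ^+ k * (x ^+ k.*2.+1 / k.*2.+1`!%:R).

Definition cos_taylor m x : R :=
  \sum_(k < m) (-1) ^+ k * (x ^+ k.*2 / k.*2`!%:R).

Lemma is_derive_monomial n x :
  is_derive x 1 (fun y => y ^+ n.+1 / n.+1`!%:R) (x ^+ n / n`!%:R).
Proof.
have -> : (fun y : R => y ^+ n.+1 / n.+1`!%:R) =
          (n.+1`!%:R^-1 : R) *: ((@id R) ^+ n.+1).
  by apply/funext => y; rewrite exprfctE mulrC.
apply: is_derive_eq.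
rewrite /GRing.scale /= mulr1 factS natrM -mulr_natl; field.
by rewrite nat1r !pnatr_eq0 -!lt0n fact_gt0.
Qed.

Lemma is_derive_sin_taylor m x :
  is_derive x 1 (sin_taylor m) (cos_taylor m x).
Proof.
elim: m => [|m IH].
  have -> : sin_taylor 0 = cst 0.
    by apply/funext => y; rewrite /sin_taylor big_ord0.
  by rewrite /cos_taylor big_ord0; exact: is_derive_cst.
have -> : sin_taylor m.+1 = sin_taylor m +
    ((-1) ^+ m : R) *: (fun y : R => y ^+ m.*2.+1 / m.*2.+1`!%:R).
  by apply/funext => y; rewrite /sin_taylor big_ord_recr.
rewrite /cos_taylor big_ord_recr /=.
by apply: is_deriveD; apply: is_deriveZ; exact: is_derive_monomial.
Qed.

Lemma is_derive_cos_taylor m x :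
  is_derive x 1 (cos_taylor m.+1) (- sin_taylor m x).
Proof.
elim: m => [|m IH].
  have -> : cos_taylor 1 = cst 1.
    by apply/funext => y; rewrite /cos_taylor big_ord1 !expr0 fact0 divr1 mulr1.
  by rewrite /sin_taylor big_ord0 oppr0; exact: is_derive_cst.
have -> : cos_taylor m.+2 = cos_taylor m.+1 +
    ((-1) ^+ m.+1 : R) *: (fun y : R => y ^+ m.+1.*2 / m.+1.*2`!%:R).
  by apply/funext => y; rewrite /cos_taylor big_ord_recr.
rewrite /sin_taylor big_ord_recr /= opprD -mulNr.
have -> : - (-1) ^+ m = (-1) ^+ m.+1 :> R by rewrite exprS mulN1r.
by apply: is_deriveD; apply: is_deriveZ; exact: is_derive_monomial.
Qed.

Lemma sin_taylor0 m : sin_taylor m 0 = 0.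
Proof. by rewrite /sin_taylor big1// => k _; rewrite expr0n mul0r mulr0. Qed.

Lemma cos_taylor0 m : cos_taylor m.+1 0 = 1.
Proof.
rewrite /cos_taylor big_ord_recl /= big1 ?addr0 => [|k _].
  by rewrite !expr0 fact0 divr1 mulr1.
by rewrite expr0n mul0r mulr0.
Qed.

(** The signed error vanishes at 0 and its derivative is the signed error of the cosine, so it
    inherits nonnegativity. *)
Lemma sin_taylor_step m :
  (forall x, 0 <= x -> 0 <= (-1) ^+ m * (cos x - cos_taylor m x)) ->
  forall x, 0 <= x -> 0 <= (-1) ^+ m * (sin x - sin_taylor m x).
Proof.
move=> H x x0.
pose f := ((-1) ^+ m : R) *: ((@sin R) - sin_taylor m).
have f0 : f 0 = 0.
  suff : (-1) ^+ m * (sin 0 - sin_taylor m 0) = 0 :> R by [].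
  by rewrite sin0 sin_taylor0 subrr mulr0.
rewrite -[leLHS]f0.
apply: (@is_derive_nondecreasing _ f
  (fun y => (-1) ^+ m * (cos y - cos_taylor m y))) => // [y|y /andP[y0 _]].
- apply: is_deriveZ; apply: is_deriveB; exact: is_derive_sin_taylor.
- exact/H/ltW.
Qed.

(** Differentiating the cosine polynomial drops its constant term and yields minus the sine
    polynomial: hence one more term and one more sign. *)
Lemma cos_taylor_step m :
  (forall x, 0 <= x -> 0 <= (-1) ^+ m * (sin x - sin_taylor m x)) ->
  forall x, 0 <= x -> 0 <= (-1) ^+ m.+1 * (cos x - cos_taylor m.+1 x).
Proof.
move=> H x x0.
pose f := ((-1) ^+ m.+1 : R) *: ((@cos R) - cos_taylor m.+1).
have f0 : f 0 = 0.
  suff : (-1) ^+ m.+1 * (cos 0 - cos_taylor m.+1 0) = 0 :> R by [].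
  by rewrite cos0 cos_taylor0 subrr mulr0.
rewrite -[leLHS]f0.
apply: (@is_derive_nondecreasing _ f
  (fun y => (-1) ^+ m.+1 * (- sin y - - sin_taylor m y)))
  => // [y|y /andP[y0 _]].
- apply: is_deriveZ; apply: is_deriveB; exact: is_derive_cos_taylor.
- by rewrite exprS mulN1r mulNr -mulrN opprB opprK addrC H// ltW.
Qed.

(** Starts from [cos x <= 1] and integrates from 0 alternately; the size of [x] is not limited,
    whereas the alternating series test needs decreasing terms. *)
Lemma taylor_alternating m x : 0 <= x ->
  0 <= (-1) ^+ m.+1 * (sin x - sin_taylor m.+1 x) /\
  0 <= (-1) ^+ m.+1 * (cos x - cos_taylor m.+1 x).
Proof.
move=> x0.
suff [H1 H2] :
    (forall x, 0 <= x -> 0 <= (-1) ^+ m.+1 * (sin x - sin_taylor m.+1 x)) /\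
    (forall x, 0 <= x -> 0 <= (-1) ^+ m.+1 * (cos x - cos_taylor m.+1 x)).
  by split; [exact: H1|exact: H2].
elim: m {x x0} => [|m [IH _]].
  suff H x : 0 <= x -> 0 <= (-1) ^+ 1 * (cos x - cos_taylor 1 x) :> R.
    by split => //; exact: sin_taylor_step.
  move=> _; rewrite /cos_taylor big_ord1 !expr0 fact0 divr1 mulr1 expr1.
  by rewrite mulN1r opprB subr_ge0 cos_le1.
have H := cos_taylor_step IH.
by split => //; exact: sin_taylor_step.
Qed.

End taylor.

(* Locked lest conversion unfold large integers into unary numbers. *)
HB.lock Definition ofZ {R : realType} (z : Z) : R := (int_of_Z z)%:~R.

(** * Rational bounds certified in integer arithmetic *)

Section numerics.
Context {R : realType}.
Local Notation ofZ := (@ofZ R).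

Lemma ofZD a b : ofZ (a + b)%BZ = ofZ a + ofZ b.
Proof. by rewrite unlock -intrD; congr intmul; lia. Qed.

Lemma ofZM a b : ofZ (a * b)%BZ = ofZ a * ofZ b.
Proof. by rewrite unlock -intrM; congr intmul; lia. Qed.

Lemma ofZX a (n : nat) : ofZ (Z.pow a (Z.of_nat n)) = ofZ a ^+ n.
Proof.
elim: n => [|n IH]; first by rewrite unlock.
by rewrite Nat2Z.inj_succ Z.pow_succ_r ?ofZM ?IH ?exprS//; lia.
Qed.

Lemma ofZN a : ofZ (- a)%BZ = - ofZ a.
Proof. by rewrite unlock -rmorphN; congr intmul; lia. Qed.

Lemma ofZ0 : ofZ 0 = 0. Proof. by rewrite unlock. Qed.

Lemma ofZ1 : ofZ 1 = 1. Proof. by rewrite unlock. Qed.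

Lemma ofZ_gt0 a : Z.ltb 0 a -> 0 < ofZ a.
Proof. rewrite unlock ltr0z; lia. Qed.

Lemma ofZ_ge0 a : Z.leb 0 a -> 0 <= ofZ a.
Proof. rewrite unlock ler0z; lia. Qed.

Lemma ofZ_lt a b : Z.ltb a b -> ofZ a < ofZ b.
Proof. rewrite unlock ltr_int; lia. Qed.

Lemma ofZ_le a b : Z.leb a b -> ofZ a <= ofZ b.
Proof. rewrite unlock ler_int; lia. Qed.

Lemma ofZ_nat (n : nat) : ofZ (Z.of_nat n) = n%:R.
Proof.
have -> : n%:R = (n%:Z)%:~R :> R by [].
by rewrite unlock; congr intmul; lia.
Qed.

(* Over the common denominator q, p is the numerator of a partial sum and t that
   of its next term t_k, where t_(k+1) = - t_k (n / d)^2 / (a (a + 1)) and a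
   grows by 2 at each step. *)
Fixpoint alternating_fraction (n d a t q p : Z) (m : nat) : Z * Z :=
  if m is m'.+1 then
    let c := (d * d * a * (a + 1))%BZ in
    alternating_fraction n d (a + 2)%BZ (- t * n * n)%BZ (q * c)%BZ
      ((p + t) * c)%BZ m'
  else (p, q).

(** Loop invariant: [t / q] is the term of index [k] and [p / q] the sum of those before it. The
    parameter [e] is the parity of the exponents, 1 for sine and 0 for cosine. *)
Lemma alternating_fractionP (term : nat -> R) (e k m : nat) (n d t q p : Z) :
  let x := ofZ n / ofZ d in
  (forall j, term j.+1 * ((j.*2 + e).+1%:R * (j.*2 + e).+2%:R) =
             - term j * x ^+ 2) ->
  Z.ltb 0 d -> Z.ltb 0 q ->
  ofZ t = ofZ q * term k -> ofZ p = ofZ q * \sum_(j < k) term j ->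
  let: (p', q') :=
    alternating_fraction n d (Z.of_nat (k.*2 + e).+1) t q p m in
  Z.ltb 0 q' /\ ofZ p' = ofZ q' * \sum_(j < k + m) term j.
Proof.
move=> x rec d0; elim: m k t q p => [|m IH] k t q p q0 tE pE.
  by rewrite addn0.
move aE : (Z.of_nat (k.*2 + e).+1) => a /=.
have -> : (a + 2 = Z.of_nat (k.+1.*2 + e).+1)%BZ by lia.
rewrite -addSnnS; apply: IH.
- apply/Z.ltb_spec0; have := (Z.ltb_spec0 0 d); rewrite d0 => /elimT/(_ isT) ?.
  by repeat apply: Z.mul_pos_pos => //; lia.
- have a1E : ofZ (a + 1) = (k.*2 + e).+2%:R.
    by rewrite -ofZ_nat; congr ofZ; lia.
  have dn0 : ofZ d != 0 by apply: lt0r_neq0; exact: ofZ_gt0.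
  rewrite !ofZM ofZN tE -aE ofZ_nat aE a1E.
  transitivity (ofZ q * (ofZ d * ofZ d) *
      (term k.+1 * ((k.*2 + e).+1%:R * (k.*2 + e).+2%:R))).
    rewrite rec /x; field; exact: dn0.
  ring.
- by rewrite !ofZM ofZD tE pE big_ord_recr /=; ring.
Qed.

(** The series starts at [n / d] for sine and at 1 for cosine; 2 and 1 are the first new factors of
    the factorial in the term that follows. *)
Definition sin_fraction (n d : Z) := alternating_fraction n d 2 n d 0.
Definition cos_fraction (n d : Z) := alternating_fraction n d 1 1 1 0.

Lemma sin_fractionP n d m : Z.ltb 0 d ->
  let: (p, q) := sin_fraction n d m in
  Z.ltb 0 q /\ sin_taylor m (ofZ n / ofZ d) = ofZ p / ofZ q.
Proof.
move=> d0; have dn0 : ofZ d != 0 by apply: lt0r_neq0; exact: ofZ_gt0.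
set x := ofZ n / ofZ d.
pose term k : R := (-1) ^+ k * (x ^+ k.*2.+1 / k.*2.+1`!%:R).
have rec j : term j.+1 * ((j.*2 + 1).+1%:R * (j.*2 + 1).+2%:R) =
    - term j * x ^+ 2.
  rewrite /term addn1 doubleS [j.*2.+3`!]factS [j.*2.+2`!]factS !exprS.
  move: (j.*2.+1`!) (fact_gt0 j.*2.+1) => f f0; rewrite !natrM; field.
  by rewrite -!natrD !pnatr_eq0 -lt0n f0.
have tE : ofZ n = ofZ d * term 0.
  by rewrite /term expr0 mul1r divr1 expr1 mulrC divfK.
have pE : ofZ 0 = ofZ d * \sum_(j < 0) term j by rewrite ofZ0 big_ord0 mulr0.
have := @alternating_fractionP term 1 0 m n d n d 0 rec d0 d0 tE pE.
rewrite -/(sin_fraction n d m).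
case: (sin_fraction n d m) => p q [q0 ->]; split=> //.
by rewrite mulrC mulKf//; apply: lt0r_neq0; exact: ofZ_gt0.
Qed.

Lemma cos_fractionP n d m : Z.ltb 0 d ->
  let: (p, q) := cos_fraction n d m in
  Z.ltb 0 q /\ cos_taylor m (ofZ n / ofZ d) = ofZ p / ofZ q.
Proof.
move=> d0; set x := ofZ n / ofZ d.
pose term k : R := (-1) ^+ k * (x ^+ k.*2 / k.*2`!%:R).
have rec j : term j.+1 * ((j.*2 + 0).+1%:R * (j.*2 + 0).+2%:R) =
    - term j * x ^+ 2.
  rewrite /term addn0 doubleS [j.*2.+2`!]factS [j.*2.+1`!]factS !exprS.
  move: (j.*2`!) (fact_gt0 j.*2) => f f0; rewrite !natrM; field.
  by rewrite nat1r -!natrD !pnatr_eq0 -lt0n f0.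
have tE : ofZ 1 = ofZ 1 * term 0%N.
  by rewrite ofZ1 /term !expr0 fact0 divr1 !mulr1.
have pE : ofZ 0 = ofZ 1 * \sum_(j < 0) term j by rewrite ofZ0 big_ord0 mulr0.
have := @alternating_fractionP term 0 0 m n d 1 1 0 rec d0 isT tE pE.
rewrite -/(cos_fraction n d m).
case: (cos_fraction n d m) => p q [q0 ->]; split=> //.
by rewrite mulrC mulKf//; apply: lt0r_neq0; exact: ofZ_gt0.
Qed.

Lemma ltr_ofZ_div (p q u v : Z) : Z.ltb 0 q -> Z.ltb 0 v ->
  Z.ltb (p * v) (u * q) -> ofZ p / ofZ q < ofZ u / ofZ v.
Proof.
move=> q0 v0 pq; rewrite ltr_pdivrMr ?ofZ_gt0// mulrAC ltr_pdivlMr ?ofZ_gt0//.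
by rewrite -!ofZM ofZ_lt.
Qed.

Lemma ofZ_div_ge0 (n d : Z) : Z.leb 0 n -> Z.ltb 0 d -> 0 <= ofZ n / ofZ d.
Proof.
by move=> n0 d0; apply: divr_ge0; [exact: ofZ_ge0|exact/ltW/ofZ_gt0].
Qed.

(** An odd number of terms overestimates; the lower bounds take [m.+1] terms, an even number. The
    last hypothesis is a cross-multiplied comparison of integers, decidable by computation. *)
Lemma sin_lt (m : nat) (n d u v : Z) :
  odd m -> Z.leb 0 n -> Z.ltb 0 d -> Z.ltb 0 v ->
  (let (p, q) := sin_fraction n d m in Z.ltb (p * v) (u * q)) ->
  sin (ofZ n / ofZ d) < ofZ u / ofZ v.
Proof.
case: m => // m mo n0 d0 v0; have := sin_fractionP n m.+1 d0.
case: (sin_fraction n d m.+1) => p q [q0 E] /(ltr_ofZ_div q0 v0).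
have [+ _] := taylor_alternating m (ofZ_div_ge0 n0 d0).
rewrite -signr_odd mo mulN1r opprB subr_ge0 E.
exact: le_lt_trans.
Qed.

Lemma lt_sin (m : nat) (n d u v : Z) :
  odd m -> Z.leb 0 n -> Z.ltb 0 d -> Z.ltb 0 v ->
  (let (p, q) := sin_fraction n d m.+1 in Z.ltb (u * q) (p * v)) ->
  ofZ u / ofZ v < sin (ofZ n / ofZ d).
Proof.
move=> mo n0 d0 v0; have := sin_fractionP n m.+1 d0.
case: (sin_fraction n d m.+1) => p q [q0 E] /(ltr_ofZ_div v0 q0).
move=> /lt_le_trans; apply.
have [+ _] := taylor_alternating m (ofZ_div_ge0 n0 d0).
by rewrite -signr_odd /= mo mul1r subr_ge0 E.
Qed.

Lemma cos_lt (m : nat) (n d u v : Z) :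
  odd m -> Z.leb 0 n -> Z.ltb 0 d -> Z.ltb 0 v ->
  (let (p, q) := cos_fraction n d m in Z.ltb (p * v) (u * q)) ->
  cos (ofZ n / ofZ d) < ofZ u / ofZ v.
Proof.
case: m => // m mo n0 d0 v0; have := cos_fractionP n m.+1 d0.
case: (cos_fraction n d m.+1) => p q [q0 E] /(ltr_ofZ_div q0 v0).
have [_ +] := taylor_alternating m (ofZ_div_ge0 n0 d0).
rewrite -signr_odd mo mulN1r opprB subr_ge0 E.
exact: le_lt_trans.
Qed.

Lemma lt_cos (m : nat) (n d u v : Z) :
  odd m -> Z.leb 0 n -> Z.ltb 0 d -> Z.ltb 0 v ->
  (let (p, q) := cos_fraction n d m.+1 in Z.ltb (u * q) (p * v)) ->
  ofZ u / ofZ v < cos (ofZ n / ofZ d).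
Proof.
move=> mo n0 d0 v0; have := cos_fractionP n m.+1 d0.
case: (cos_fraction n d m.+1) => p q [q0 E] /(ltr_ofZ_div v0 q0).
move=> /lt_le_trans; apply.
have [_ +] := taylor_alternating m (ofZ_div_ge0 n0 d0).
by rewrite -signr_odd /= mo mul1r subr_ge0 E.
Qed.

(** Cosine decreases strictly on [0, pi] and vanishes at pi / 2, so its signs at two consecutive
    multiples of 1e-19 enclose pi / 2. That both lie in [0, pi] follows from [2 <= pi]. *)
Lemma pihalf_bounds :
  ofZ 15707963267948966192 / ofZ (10 ^ 19) < pi / 2 :> R /\
  pi / 2 < ofZ 15707963267948966193 / ofZ (10 ^ 19) :> R.
Proof.
have pi2 := @pi_ge2 R; have cp := @cos_pihalf R.
have H1 : 0 < cos (ofZ 15707963267948966192 / ofZ (10 ^ 19)) :> R.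
  rewrite -[ltLHS](mul0r (ofZ 1)^-1) -[X in X / _]ofZ0.
  by apply: (@lt_cos 13); vm_compute.
have H2 : cos (ofZ 15707963267948966193 / ofZ (10 ^ 19)) < 0 :> R.
  rewrite -[ltRHS](mul0r (ofZ 1)^-1) -[X in X / _]ofZ0.
  by apply: (@cos_lt 13); vm_compute.
have ofZ2 : ofZ 2 = 2 by exact: (ofZ_nat 2).
have bd k : Z.leb 0 k -> Z.leb k (2 * 10 ^ 19)%BZ ->
    0 <= ofZ k / ofZ (10 ^ 19) <= pi.
  move=> k0 k2; rewrite divr_ge0 ?ofZ_ge0//=; apply: le_trans pi2.
  by rewrite ler_pdivrMr ?ofZ_gt0// -ofZ2 -ofZM ofZ_le.
split.
- rewrite -ltr_cos ?in_itv/= ?bd//; first by rewrite cp.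
  by apply/andP; split; lra.
- rewrite -ltr_cos ?in_itv/= ?bd//; first by rewrite cp.
  by apply/andP; split; lra.
Qed.

End numerics.

(** * The critical angle: location and uniqueness of the zero *)

Section critical_angle.
Context {R : realType}.
Implicit Types t b x y : R.

Lemma sin_double t : sin (2 * t) = 2 * sin t * cos t.
Proof. by rewrite mulr_natl sin_mulr2n -mulr_natl; ring. Qed.

Lemma cos_double t : cos (2 * t) = 2 * cos t ^+ 2 - 1.
Proof. by rewrite mulr_natl cos_mulr2n -mulr_natl. Qed.

Lemma sin_le_id t : 0 <= t -> sin t <= t.
Proof.
move=> /(taylor_alternating 0)[+ _].
by rewrite /sin_taylor big_ord1 expr0 mul1r divr1 !expr1; lra.
Qed.

Lemma le_cos x y : 0 <= x -> y <= pi -> x <= y -> cos y <= cos x.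
Proof.
move=> x0 ypi xy.
have xI : x \in `[0, pi] by rewrite in_itv/= x0 (le_trans xy).
have yI : y \in `[0, pi] by rewrite in_itv/= ypi (le_trans x0).
by rewrite leNgt ltr_cos// -leNgt.
Qed.

(* beta solves the equation iff pi * beta is a zero of [angle_fun]. *)
Definition angle_fun t : R := sin (2 * t) - sin t - t * cos t.

Lemma is_derive_double t : is_derive t 1 (fun s : R => 2 * s) 2.
Proof.
have -> : (fun s : R => 2 * s) = (2 : R) *: (@id R) by [].
by apply: is_derive_eq; rewrite /GRing.scale /= mulr1.
Qed.

Lemma is_derive_sin_double t :
  is_derive t 1 (fun s : R => sin (2 * s)) (2 * cos (2 * t)).
Proof.
have ? := is_derive_double t.
have -> : (fun s : R => sin (2 * s)) = @sin R \o (fun s : R => 2 * s) by [].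
by apply: is_derive_eq; rewrite mulrC.
Qed.

Lemma is_derive_angle_fun t :
  is_derive t 1 angle_fun (2 * cos (2 * t) - cos t - (cos t - t * sin t)).
Proof.
have -> : angle_fun =
    (fun s : R => sin (2 * s)) - @sin R - (@id R) * (@cos R) by [].
have ? := is_derive_sin_double t.
apply: is_derive_eq; rewrite /GRing.scale /=; ring.
Qed.

(** Put s = sin t and c = cos t. If c >= 0, then s <= t makes the function at most - s (1 - c) < 0.
    If -1/2 <= c < 0, a zero satisfies t = s (2 - 1 / c) >= 4 s > 32/10, which exceeds pi. *)
Lemma root_angle_cos t : 0 < t < pi -> angle_fun t = 0 -> cos t < - (1 / 2).
Proof.
move=> t0pi; have /andP[t0 tpi] := t0pi.
have s0 := sin_gt0_pi t0pi.
rewrite /angle_fun sin_double => E; rewrite ltNge; apply/negP => c12.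
have st := sin_le_id (ltW t0).
have sc := cos2Dsin2 t; have c1 := cos_le1 t.
have t32 : t < 32 / 10.
  have [_] := @pihalf_bounds R.
  have : ofZ 15707963267948966193 / ofZ (10 ^ 19) <= 16 / 10 :> R.
    have -> : 16 / 10 = ofZ 16 / ofZ 10 :> R.
      by rewrite (ofZ_nat 16) (ofZ_nat 10).
    rewrite ler_pdivrMr ?ofZ_gt0// mulrAC ler_pdivlMr ?ofZ_gt0// -!ofZM.
    by rewrite ofZ_le.
  by move: tpi; lra.
move: (sin t) (cos t) => s c in s0 E c12 st sc c1 *.
have [c0|c0] := leP 0 c.
  have : s * c <= t * c by rewrite ler_wpM2r.
  have c1' : c < 1.
    rewrite lt_neqAle c1 andbT; apply/eqP => cE.
    by have := exprn_gt0 2 s0; move: sc; rewrite cE; lra.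
  have : 0 < s * (1 - c) by rewrite mulr_gt0// subr_gt0.
  lra.
(* From c^2 <= 1/4 follows s^2 >= 3/4 > (8/10)^2. *)
have s8 : 8 / 10 < s by nra.
nra.
Qed.

(** The derivative is 2 (2 c + 1) (c - 1) + t sin t with c = cos t; both factors are negative once c
    < -1/2, and cosine stays below its value at [t1]. *)
Lemma angle_fun_increasing t1 t2 : 0 < t1 -> t2 < pi -> cos t1 < - (1 / 2) ->
  t1 < t2 -> angle_fun t1 < angle_fun t2.
Proof.
move=> t10 t2pi c1 t12.
apply: (is_derive_increasing is_derive_angle_fun) => // t /andP[t1t tt2].
have s0 : 0 < sin t by rewrite sin_gt0_pi// (lt_trans t10)//= (lt_trans tt2).
have c : cos t < - (1 / 2).
  by apply: le_lt_trans c1; rewrite le_cos// ltW// (lt_trans tt2).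
have ts0 : 0 < t * sin t by rewrite mulr_gt0// (lt_trans t10).
rewrite cos_double; nra.
Qed.

Lemma root_angle_unique t1 t2 : 0 < t1 < pi -> 0 < t2 < pi ->
  angle_fun t1 = 0 -> angle_fun t2 = 0 -> t1 = t2.
Proof.
wlog : t1 t2 / t1 <= t2 => [H|].
  by have [/H//|/ltW/H h ? ? ? ?] := leP t1 t2; rewrite h.
rewrite le_eqVlt => /predU1P[//|t12] t1pi t2pi E1 E2.
have := root_angle_cos t1pi E1; move: t1pi t2pi => /andP[t10 _] /andP[_ t2pi].
by move=> /(angle_fun_increasing t10 t2pi)/(_ t12); rewrite E1 E2 ltxx.
Qed.

Let D : Z := 10 ^ 19.

Lemma root_angle_exists :
  exists2 t, ofZ 23693879252970869750 / ofZ D <= t <=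
             ofZ 23693879252970869770 / ofZ D & angle_fun t = 0.
Proof.
have D0 : 0 < ofZ D :> R by rewrite ofZ_gt0.
have dbl n : 2 * (ofZ n / ofZ D) = ofZ (2 * n)%BZ / ofZ D :> R.
  by rewrite mulrA ofZM (ofZ_nat 2).
(* Over the common denominator [ofZ D ^+ 2] each sign becomes a comparison of integers. *)
have comb a b c n : a / ofZ D - b / ofZ D - n / ofZ D * (c / ofZ D) =
    (a * ofZ D - b * ofZ D - n * c) / ofZ D ^+ 2 :> R.
  by field; rewrite lt0r_neq0.
have lo : angle_fun (ofZ 23693879252970869750 / ofZ D) <= 0.
  rewrite /angle_fun dbl.
  (* One bound for the double angle serves at both ends, since sin (2 t) increases through it. The
     argument, about 4.74, takes 21 or 22 terms, against 15 or 16 at about 2.37. *)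
  have S2 : sin (ofZ (2 * 23693879252970869750) / ofZ D) <
      ofZ (-9996518867392894153) / ofZ D :> R.
    by apply: (@sin_lt _ 21); vm_compute.
  have S : ofZ 6977163434142571491 / ofZ D <
      sin (ofZ 23693879252970869750 / ofZ D) :> R.
    by apply: (@lt_sin _ 15); vm_compute.
  have C : ofZ (-7163741369791614584) / ofZ D <
      cos (ofZ 23693879252970869750 / ofZ D) :> R.
    by apply: (@lt_cos _ 15); vm_compute.
  apply: (@le_trans _ _ (ofZ (-9996518867392894153) / ofZ D -
      ofZ 6977163434142571491 / ofZ D -
      ofZ 23693879252970869750 / ofZ D * (ofZ (-7163741369791614584) / ofZ D))).
    apply: lerB; first by apply: lerB; exact: ltW.
    by apply: ler_wpM2l; [rewrite divr_ge0 ?ofZ_ge0|exact: ltW].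
  rewrite comb pmulr_lle0 ?invr_gt0 ?exprn_gt0//.
  by rewrite -!ofZM -!ofZN -!ofZD -ofZ0 ofZ_le.
have hi : 0 <= angle_fun (ofZ 23693879252970869770 / ofZ D).
  rewrite /angle_fun dbl.
  have S2 : ofZ (-9996518867392894153) / ofZ D <
      sin (ofZ (2 * 23693879252970869770) / ofZ D) :> R.
    by apply: (@lt_sin _ 21); vm_compute.
  have S : sin (ofZ 23693879252970869770 / ofZ D) <
      ofZ 6977163434142571478 / ofZ D :> R.
    by apply: (@sin_lt _ 15); vm_compute.
  have C : cos (ofZ 23693879252970869770 / ofZ D) <
      ofZ (-7163741369791614597) / ofZ D :> R.
    by apply: (@cos_lt _ 15); vm_compute.
  apply: (@le_trans _ _ (ofZ (-9996518867392894153) / ofZ D -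
      ofZ 6977163434142571478 / ofZ D -
      ofZ 23693879252970869770 / ofZ D * (ofZ (-7163741369791614597) / ofZ D))).
    rewrite comb; apply: divr_ge0; last by rewrite exprn_ge0// ltW.
    by rewrite -!ofZM -!ofZN -!ofZD ofZ_ge0.
  apply: lerB; first by apply: lerB; exact: ltW.
  by apply: ler_wpM2l; [rewrite divr_ge0 ?ofZ_ge0|exact: ltW].
have le12 : ofZ 23693879252970869750 / ofZ D <=
    ofZ 23693879252970869770 / ofZ D :> R.
  by rewrite ler_pM2r ?invr_gt0// ofZ_le.
have cf : {within `[ofZ 23693879252970869750 / ofZ D,
                    ofZ 23693879252970869770 / ofZ D], continuous angle_fun}.
  apply: derivable_within_continuous => x _.
  by have [] := is_derive_angle_fun x.
have [] := @IVT _ _ _ _ 0 le12 cf; last by move=> t; rewrite in_itv; exists t.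
by rewrite ge_min lo le_max hi orbT.
Qed.

End critical_angle.

(** * The root [beta] and its decimals *)

Section root.
Context {R : realType}.
Implicit Types t beta : R.

Lemma beta_equationE beta :
  beta_equation beta <-> 0 < pi * beta < pi /\ angle_fun (pi * beta) = 0.
Proof.
have pi0 := @pi_gt0 R.
rewrite /beta_equation /angle_fun mulrA pmulr_rgt0//.
have -> : (pi * beta < pi) = (beta < 1) by rewrite -[ltRHS]mulr1 ltr_pM2l.
split=> -[-> E]; split=> //; last rewrite [beta * pi]mulrC.
  by rewrite E [beta * pi]mulrC subrr.
by move: E => /eqP; rewrite subr_eq0 => /eqP.
Qed.

Lemma root_angle_range t :
  ofZ 23693879252970869750 / ofZ (10 ^ 19) <= t ->
  t <= ofZ 23693879252970869770 / ofZ (10 ^ 19) -> 0 < t < pi.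
Proof.
move=> tl tu; have [lo _] := @pihalf_bounds R; apply/andP; split.
  by apply: lt_le_trans tl; rewrite divr_gt0 ?ofZ_gt0.
apply: (le_lt_trans tu); rewrite -[pi](@divfK _ 2)//.
rewrite -ltr_pdivrMr//; apply: lt_trans lo.
rewrite -(ofZ_nat 2) ltr_pdivrMr ?ofZ_gt0// mulrAC.
by rewrite ltr_pM2r ?invr_gt0 ?ofZ_gt0// -ofZM ofZ_lt.
Qed.

Lemma beta_equation_unique : exists! beta : R, beta_equation beta.
Proof.
have pi0 := @pi_gt0 R; have [t /andP[tl tu] t0] := @root_angle_exists R.
have tpi := root_angle_range tl tu.
exists (t / pi); split=> [|beta /beta_equationE[bpi b0]].
  by apply/beta_equationE; rewrite mulrC divfK ?lt0r_neq0.
by rewrite (root_angle_unique tpi bpi t0 b0) mulrC mulKf// lt0r_neq0.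
Qed.

(** By uniqueness [beta] is the bracketed zero divided by pi; the bracket and the enclosure of pi /
    2 place it strictly within two units of the last digit. *)
Lemma beta_equation_approx beta :
  beta_equation beta -> `|beta - beta_approx| < 2 / 10 ^+ 16.
Proof.
move=> /beta_equationE[bpi b0].
have pi0 := @pi_gt0 R; have [lo hi] := @pihalf_bounds R.
have [t /andP[tl tu] t0] := @root_angle_exists R.
have tpi := root_angle_range tl tu.
have bt : beta = t / pi.
  by rewrite -(root_angle_unique bpi tpi b0 t0) mulrC mulKf ?lt0r_neq0.
have X k n : k = Z.of_nat n -> ofZ (10 ^ k) = 10 ^+ n :> R.
  by move=> ->; rewrite ofZX (ofZ_nat 10).
have M a k n : k = Z.of_nat n -> ofZ (a * 10 ^ k) = ofZ a * 10 ^+ n :> R.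
  by move=> /X <-; rewrite ofZM.
have E : beta_approx = ofZ 7541996008265638 / ofZ (10 ^ 16) :> R.
  have -> : ofZ 7541996008265638 = ofZ (754 * 10 ^ 13 + (199 * 10 ^ 10 +
      (600 * 10 ^ 7 + (826 * 10 ^ 4 + (563 * 10 + 8))))) :> R.
    by apply: (congr1 (@ofZ R)); vm_compute.
  rewrite 5!ofZD (M _ _ 13%N)// (M _ _ 10%N)// (M _ _ 7%N)// (M _ _ 4%N)//
    (X _ 16%N)//.
  rewrite ofZM (ofZ_nat 10).
  rewrite (ofZ_nat 754) (ofZ_nat 199) (ofZ_nat 600) (ofZ_nat 826) (ofZ_nat 563).
  rewrite (ofZ_nat 8) /beta_approx.
  have : (10 : R) != 0 by rewrite pnatr_eq0.
  (* With 10 abstracted to a variable, this is an identity of rational functions with small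
     coefficients. *)
  move: (10 : R) => x x0; field; exact: x0.
have D0 : 0 < ofZ (10 ^ 16) :> R by rewrite ofZ_gt0.
have P0 : 0 < ofZ (10 ^ 19) :> R by rewrite ofZ_gt0.
have E2 : 2 = ofZ 2 :> R by rewrite (ofZ_nat 2).
rewrite ltr_distl E -(X 16%BZ)// E2 -mulrBl -mulrDl bt -ofZN -!ofZD.
have pi2 : pi = pi / 2 * ofZ 2 :> R by rewrite (ofZ_nat 2) divfK.
have comb a p : ofZ a / ofZ (10 ^ 16) * (ofZ p / ofZ (10 ^ 19) * ofZ 2) =
    ofZ (a * p * 2) / ofZ (10 ^ 16) / ofZ (10 ^ 19) :> R.
  rewrite 2!ofZM; move: (ofZ (10 ^ 16)) (ofZ (10 ^ 19)) D0 P0 => x y x0 y0.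
  by field; rewrite !lt0r_neq0.
apply/andP; split.
- rewrite ltr_pdivlMr//; apply: lt_le_trans tl.
  apply: (@lt_trans _ _ (ofZ 7541996008265636 / ofZ (10 ^ 16) *
      (ofZ 15707963267948966193 / ofZ (10 ^ 19) * ofZ 2))).
    by rewrite ltr_pM2l ?divr_gt0 ?ofZ_gt0// pi2 ltr_pM2r ?ofZ_gt0.
  by rewrite comb ltr_pM2r ?invr_gt0// ltr_pdivrMr// -ofZM ofZ_lt.
- rewrite ltr_pdivrMr//; apply: (le_lt_trans tu).
  apply: (@lt_trans _ _ (ofZ 7541996008265640 / ofZ (10 ^ 16) *
      (ofZ 15707963267948966192 / ofZ (10 ^ 19) * ofZ 2))); last first.
    by rewrite ltr_pM2l ?divr_gt0 ?ofZ_gt0// pi2 ltr_pM2r ?ofZ_gt0.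
  by rewrite comb ltr_pM2r ?invr_gt0// ltr_pdivlMr// -ofZM ofZ_lt.
Qed.

End root.

(** * The dual potential and its inequality *)

Section potential.
Context {R : realType} (b : R).
Context (b0pi : 0 < b < pi) (rootb : angle_fun b = 0).
Implicit Types x y t : R.

Let cosb : cos b < - (1 / 2). Proof. exact: root_angle_cos. Qed.
Let b0 : 0 < b. Proof. by case/andP: b0pi. Qed.
Let bpi : b < pi. Proof. by case/andP: b0pi. Qed.
Let sinb2 : sin (2 * b) = sin b + b * cos b.
Proof. by move: rootb; rewrite /angle_fun; lra. Qed.

Let pib : pi < 2 * b.
Proof.
rewrite ltNge; apply/negP => b2.
have : 0 <= cos b by apply: cos_ge0_pihalf; move: b0; lra.
by move: cosb; lra.
Qed.

Let cos_2piB t : cos (2 * pi - t) = cos t.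
Proof. by rewrite -[RHS]cosN -[RHS]cosD2pi -mulr_natl; congr cos; ring. Qed.

(** Reflection about pi carries the part beyond pi back to [b, pi]. *)
Lemma cos_le_cosb t : b <= t <= 2 * pi - b -> cos t <= cos b.
Proof.
move=> /andP[bt t2]; have [tpi|pit] := leP t pi.
  by apply: le_cos => //; exact: ltW.
have -> : cos t = cos (2 * pi - t).
  by rewrite cos_2piB.
by apply: le_cos; move: b0; lra.
Qed.

(** The second interval folds onto [0, b] by reflection about pi and by periodicity. *)
Lemma cosb_le_cos t :
  0 <= t <= b \/ 2 * pi - b <= t <= 2 * pi + b -> cos b <= cos t.
Proof.
have pi0 := @pi_gt0 R.
move=> [/andP[t0 tb]|/andP[t1 t2]]; first by apply: le_cos => //; exact: ltW.
have [t2pi|t2pi] := leP t (2 * pi).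
  have -> : cos t = cos (2 * pi - t).
    by rewrite cos_2piB.
  by apply: le_cos; move: b0 bpi; lra.
have -> : cos t = cos (t - 2 * pi).
  by rewrite -[RHS](@cosD2pi R) -mulr_natl; congr cos; ring.
by apply: le_cos; move: bpi; lra.
Qed.

Lemma is_derive_affine_sub_sin (c d y t : R) :
  is_derive t 1 (fun s : R => c * s + d - sin (s + y)) (c - cos (t + y)).
Proof.
have ? : is_derive t 1 (fun s : R => s + y) 1.
  have -> : (fun s : R => s + y) = (@id R) + cst y by [].
  by apply: is_derive_eq; rewrite addr0.
have -> : (fun s : R => c * s + d - sin (s + y)) =
    (c *: (@id R) + cst d) - (@sin R \o (fun s : R => s + y)) by [].
by apply: is_derive_eq; rewrite /GRing.scale /= addr0 !mulr1.
Qed.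

(* h' s = cos b - cos (s + y) changes sign only at s + y = b, from - to +, and
   at s + y = 2 pi - b, from + to -, so the minimum of h over [0, e] is attained
   at 0, at b - y or at e. *)
Lemma affine_sub_sin_ge (c0 y x : R) : 0 <= y -> 0 <= x ->
  let h s := cos b * s + c0 - sin (s + y) in
  forall e, y + e <= 2 * pi + b -> x <= e ->
  0 <= h e -> (y < b -> 0 <= h (b - y)) -> (b <= y -> 0 <= h 0) ->
  0 <= h x.
Proof.
move=> y0 x0 h e ye xe he hb hlo.
have dh := is_derive_affine_sub_sin (cos b) c0 y.
have dhN t : is_derive t 1 (- h) (- (cos b - cos (t + y))).
  exact: is_deriveN.
have [xyb|bxy] := leP (x + y) b.
  have [yb|yb] := ltP y b; last first.
    have -> : x = 0 by lra.
    exact: hlo.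
  apply: le_trans (hb yb) _; rewrite -lerN2.
  apply: (is_derive_nondecreasing dhN); last by lra.
  move=> t /andP[t1 t2]; rewrite oppr_ge0 subr_le0.
  by apply: cosb_le_cos; left; apply/andP; split; lra.
have [xy1|xy1] := leP (x + y) (2 * pi - b).
  have inc a : b <= a + y -> a <= x -> h a <= h x.
    move=> ba ax; apply: (is_derive_nondecreasing dh) => // t /andP[t1 t2].
    by rewrite subr_ge0; apply: cos_le_cosb; apply/andP; split; lra.
  have [yb|yb] := ltP y b.
    by apply: le_trans (hb yb) _; apply: inc; lra.
  by apply: le_trans (hlo yb) _; apply: inc; lra.
apply: (le_trans he); rewrite -lerN2.
apply: (is_derive_nondecreasing dhN) => // t /andP[t1 t2].
rewrite oppr_ge0 subr_le0.
by apply: cosb_le_cos; right; apply/andP; split; lra.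
Qed.

(** The right side is sin (x + y) cos (x - y), and sin (x + y) <= 0 because pi < 2 b <= x + y <= 2
    pi; multiplying it by a factor at most 1 cannot lower it. *)
Lemma sin_add_le_of_ge x y : b <= x <= pi -> b <= y <= pi ->
  sin (x + y) <= sin (2 * x) / 2 + sin (2 * y) / 2.
Proof.
move=> /andP[bx xpi] /andP[by_ ypi].
have -> : sin (2 * x) / 2 + sin (2 * y) / 2 = sin (x + y) * cos (x - y).
  have -> : 2 * x = (x + y) + (x - y) by ring.
  have -> : 2 * y = (x + y) - (x - y) by ring.
  by move: (x + y) (x - y) => u v; rewrite sinD sinB; field.
have s0 : sin (x + y) <= 0.
  have -> : x + y = (x + y - pi) + pi by ring.
  rewrite sinDpi oppr_le0 sin_ge0_pi//.
  by move: pib; lra.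
by have := cos_le1 (x - y); nra.
Qed.

(** Equality at the pairs (t, b - t) forces slope cos b, by the first-order condition, and the sum
    sin b then fixes the constant; equality on the diagonal forces the second piece. *)
Definition potential t : R :=
  if t < b then cos b * (t - b / 2) + sin b / 2 else sin (2 * t) / 2.

(* Continuity of the potential at b: this is the equation that defines beta. *)
Lemma potential_pieces_agree : sin (2 * b) / 2 = cos b * (b / 2) + sin b / 2.
Proof. by rewrite sinb2; field. Qed.

(** In x the excess is least at an end of [0, b], as b - y <= 0. At b the pieces agree and
    [sin_add_le_of_ge] applies; at 0 the excess vanishes for y = b and grows with y. *)
Lemma sin_add_le_of_lt_ge x y : 0 <= x <= b -> b <= y <= pi ->
  sin (x + y) <= cos b * (x - b / 2) + sin b / 2 + sin (2 * y) / 2.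
Proof.
move=> /andP[x0 xb] /andP[by_ ypi].
pose c0 := - (cos b * (b / 2)) + sin b / 2 + sin (2 * y) / 2.
rewrite -subr_ge0.
have -> : cos b * (x - b / 2) + sin b / 2 + sin (2 * y) / 2 - sin (x + y) =
  cos b * x + c0 - sin (x + y) by rewrite /c0; ring.
apply: (@affine_sub_sin_ge c0 y x _ x0 b) => //.
- by move: b0; lra.
- by move: bpi; lra.
- rewrite /c0; have := @sin_add_le_of_ge b y; rewrite potential_pieces_agree.
  by move=> /(_ ltac:(by rewrite lexx ltW) ltac:(by rewrite by_)); lra.
- by rewrite ltNge by_.
move=> _; rewrite mulr0 !add0r.
(* sin (2 s) / 2 - sin s increases on [b, pi], where cos s <= -1/2. *)
have dk t : is_derive t 1 (fun s : R => 2^-1 * sin (2 * s) - sin s)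
    (cos (2 * t) - cos t).
  have -> : (fun s : R => 2^-1 * sin (2 * s) - sin s) =
      (2^-1 : R) *: (fun s : R => sin (2 * s)) - @sin R by [].
  have ? := is_derive_sin_double t.
  by apply: is_derive_eq; rewrite /GRing.scale /= mulrA mulVf// mul1r.
have := is_derive_nondecreasing dk _ by_; rewrite sinb2.
suff k' t : b < t < y -> 0 <= cos (2 * t) - cos t.
  by move=> /(_ k'); rewrite /c0; lra.
move=> /andP[bt ty]; have : cos t <= cos b.
  by apply: le_cos; move: b0 bpi; lra.
(* The difference factors as (2 c + 1) (c - 1) with c = cos t <= cos b < -1/2. *)
by rewrite cos_double; have := cosb; nra.
Qed.

(** Only u = x + y matters, so [affine_sub_sin_ge] is used with second variable 0 on [0, 2 b]. The
    difference vanishes at u = b and, by the equation for b, at u = 2 b. *)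
Lemma sin_add_le_of_lt x y : 0 <= x < b -> 0 <= y < b ->
  sin (x + y) <= cos b * (x + y - b) + sin b.
Proof.
move=> /andP[x0 xb] /andP[y0 yb]; rewrite -subr_ge0.
have -> : cos b * (x + y - b) + sin b - sin (x + y) =
    cos b * (x + y) + (sin b - b * cos b) - sin (x + y + 0).
  by rewrite addr0; ring.
have xy0 : 0 <= x + y by rewrite addr_ge0.
apply: (@affine_sub_sin_ge _ 0 (x + y) _ xy0 (2 * b)) => //.
- by move: bpi; lra.
- by move: xb yb; lra.
- by rewrite addr0 sinb2; lra.
- by move=> _; rewrite subr0 addr0; lra.
- by rewrite leNgt b0.
Qed.

Lemma potential_ge x y : 0 <= x <= pi -> 0 <= y <= pi ->
  sin (x + y) <= potential x + potential y.
Proof.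
move=> /andP[x0 xpi] /andP[y0 ypi]; rewrite /potential.
have [xb|bx] := ltP x b; have [yb|by_] := ltP y b.
- have := @sin_add_le_of_lt x y; rewrite x0 y0 xb yb => /(_ isT isT); lra.
- by apply: sin_add_le_of_lt_ge; apply/andP; split; rewrite // ltW.
- rewrite addrC [leRHS]addrC.
  by apply: sin_add_le_of_lt_ge; apply/andP; split; rewrite // ltW.
- by apply: sin_add_le_of_ge; apply/andP.
Qed.

(** For x = 0 the partner b lies on the other piece, where the agreement at b is used. *)
Lemma potential_reflect x :
  0 <= x < b -> potential x + potential (b - x) = sin b.
Proof.
move=> /andP[x0 xb]; rewrite /potential xb.
case: ltP => [_|bx]; first by field.
have -> : x = 0 by lra.
by rewrite subr0 potential_pieces_agree; field.
Qed.

Lemma potential_refl x : b <= x -> potential x + potential x = sin (x + x).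
Proof.
by move=> bx; rewrite /potential ltNge bx /= (_ : x + x = 2 * x); [field|ring].
Qed.

End potential.

(** * The uniform law and its invariance under [Gamma] *)

Section uniform_measure.
Context {R : realType}.
Local Notation leb := (@lebesgue_measure R).
Local Notation unif := (uniform_prob (@ltr01 R)).

Lemma uniform_prob01E (A : set R) :
  measurable A -> unif A = leb (A `&` `[0, 1]).
Proof.
move=> mA; rewrite /uniform_prob integral_uniform_pdf.
under eq_integral => x.
  rewrite inE /= in_itv/= => -[_ x01].
  rewrite /uniform_pdf x01 subr0 invr1; over.
by rewrite integral_cst ?mul1e//; exact: measurableI.
Qed.

(** Lebesgue measure is determined by its values on the intervals []a, b]]; reflection moves the
    closed end to the other side and keeps the length. *)
Lemma lebesgue_measure_reflect (c : R) (A : set R) : measurable A ->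
  leb ((fun x => c - x) @^-1` A) = leb A.
Proof.
move=> mA.
pose r : measurableTypeR R -> measurableTypeR R := fun x => c - x.
have mr : measurable_fun setT r by exact: measurable_funB.
apply/esym; apply: (@lebesgue_measure_unique _ (pushforward leb r)) => //=.
move=> _ [[a b]] _ <-.
rewrite /pushforward.
have -> : (fun x : R => c - x) @^-1` `]a, b]%classic = `[c - b, c - a[%classic.
  apply/seteqP; split=> x /=; rewrite !in_itv/= => /andP[? ?];
    by apply/andP; split; lra.
rewrite !lebesgue_measure_itv/= !lte_fin ltrD2l ltrN2.
by case: ifP => // _; rewrite -!EFinB; congr EFin; ring.
Qed.

(** On [beta, 1] the map is the identity; on [0, beta) it is a reflection onto (0, beta], which
    differs from [0, beta) by two points only, a null set. *)
Lemma uniform_prob_Gamma (beta : R) (A : set R) : 0 < beta < 1 ->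
  measurable A -> unif (Gamma beta @^-1` A) = unif A.
Proof.
move=> /andP[b0 b1] mA.
have mGA : measurable (Gamma beta @^-1` A).
  by rewrite -[X in measurable X]setTI; exact: measurable_Gamma.
rewrite !uniform_prob01E//.
have split_at (B : set R) : measurable B ->
    leb (B `&` `[0, 1]) = (leb (B `&` `[0%R, beta[%classic) +
                           leb (B `&` `[beta, 1%R]%classic))%E.
  move=> mB; rewrite -measureU//; first last.
  - apply/seteqP; split=> // x [[_ /=]]; rewrite in_itv/= => /andP[_ xb] [_ /=].
    by rewrite in_itv/= leNgt xb.
  - exact: measurableI.
  - exact: measurableI.
  rewrite -setIUr; congr (leb (_ `&` _)).
  apply/seteqP; split=> x /=; rewrite !in_itv/=.
    by move=> /andP[x0 x1]; case: ltP => _; [left|right]; rewrite ?x0 ?x1.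
  by case=> /andP[? ?]; apply/andP; split; lra.
rewrite !split_at//; congr (_ + _)%E; last first.
  congr (leb _); apply/seteqP; split=> x [/= Ax xI]; split=> //;
    move: Ax xI; rewrite in_itv/= /Gamma => + /andP[bx _]; by rewrite ltNge bx.
have -> : Gamma beta @^-1` A `&` `[0, beta[%classic =
    (fun x => beta - x) @^-1` (A `&` `]0, beta]).
  apply/seteqP; split=> x /=; rewrite !in_itv/= /Gamma => -[Ax /andP[h1 h2]].
    by move: Ax; rewrite h2 => Ax; split=> //; apply/andP; split; lra.
  have xb : x < beta by lra.
  by rewrite xb; split=> //; apply/andP; split; lra.
rewrite lebesgue_measure_reflect; last exact: measurableI.
transitivity (leb (A `&` `]0, beta[)).
  have -> : A `&` `]0, beta]%classic =
      (A `&` `]0, beta[) `|` (A `&` [set beta]).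
    by rewrite -setIUr setUitv1.
  rewrite measureU0//; try exact: measurableI.
  apply: (subset_measure0 _ _ _ (lebesgue_measure_set1 beta)) => //.
  exact: measurableI.
have -> : A `&` `[0, beta[%classic = (A `&` `]0, beta[) `|` (A `&` [set 0]).
  by rewrite -setIUr setUC setU1itv.
rewrite measureU0//; try exact: measurableI.
apply: (subset_measure0 _ _ _ (lebesgue_measure_set1 0)) => //.
exact: measurableI.
Qed.

End uniform_measure.

(** * Integrals against copulas *)

Section transport.
Context {R : realType}.
Local Notation unif := (uniform_prob (@ltr01 R)).

Lemma bounded_integrable d (T : measurableType d) (mu : probability T R)
    (D : set T) (f : T -> R) (M : R) :
  measurable D -> measurable_fun D f -> (forall x, `|f x| <= M) ->
  mu.-integrable D (EFin \o f).
Proof.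
move=> mD mf fM; apply: measurable_bounded_integrable => //.
  by rewrite (le_lt_trans (probability_le1 _ _)) ?ltry.
exists M; split; rewrite ?num_real// => N MN x _ /=.
by rewrite (le_trans (fM x)) ?ltW.
Qed.

Lemma measurable_unit_square : measurable (@unit_square R).
Proof. exact: measurableX. Qed.

(** The complement is a union of two strips, each null by the uniformity of one marginal. *)
Lemma copula_unit_squareC (C : probability (R * R)%type R) :
  copula C -> C (~` unit_square) = 0%E.
Proof.
move=> [C1 C2].
have mI : measurable (~` `[0, 1]%classic : set R) by exact: measurableC.
have u0 : unif (~` `[0, 1]%classic) = 0%E.
  by rewrite uniform_prob01E// setICl measure0.
have h1 : C (fst @^-1` (~` `[0, 1]%classic)) = 0%E by rewrite -u0 -C1.
have h2 : C (snd @^-1` (~` `[0, 1]%classic)) = 0%E by rewrite -u0 -C2.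
have m1 : measurable ((fst : R * R -> R) @^-1` (~` `[0, 1]%classic)).
  by rewrite -[X in measurable X]setTI; exact: measurable_fst.
have m2 : measurable ((snd : R * R -> R) @^-1` (~` `[0, 1]%classic)).
  by rewrite -[X in measurable X]setTI; exact: measurable_snd.
have -> : ~` @unit_square R =
    (fst @^-1` (~` `[0, 1]%classic)) `|` (snd @^-1` (~` `[0, 1]%classic)).
  apply/seteqP; split=> -[x y] /=; last by case=> h [].
  by move=> /not_andP.
by rewrite measureU0.
Qed.

(** Meant for [phi] a projection. The null complement of the square is added to the domain and the
    integral pushed forward; the image law and [mu] agree on measurable sets. *)
Lemma integral_marginal (C : probability (R * R)%type R) (phi : R * R -> R)
    (g : R -> R) (M : R) (mu : probability R R) : copula C ->
  measurable_fun setT phi -> uniform01 (pushforward C phi) -> uniform01 mu ->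
  measurable_fun setT g -> (forall x, `|g x| <= M) ->
  (\int[C]_(p in unit_square) (g (phi p))%:E = \int[mu]_x (g x)%:E)%E.
Proof.
move=> cC mphi uphi umu mg gM.
have mgphi : measurable_fun setT (g \o phi) by exact: measurableT_comp.
have ig : C.-integrable setT (EFin \o (g \o phi)).
  by apply: (@bounded_integrable _ _ _ _ _ M) => // x; exact: gM.
transitivity (\int[C]_p ((EFin \o g) \o phi) p)%E.
  rewrite [RHS](negligible_integral _ _ ig (copula_unit_squareC cC))//.
    by rewrite setTD setCK.
  by apply: measurableC; exact: measurable_unit_square.
rewrite -[setT](preimage_setT phi) -integral_pushforward//; last first.
  exact/measurable_EFinP.
apply: (@eq_measure_integral _ _ R setT mu (pushforward C phi)) => A mA _.
by transitivity (unif A); [exact: uphi|exact/esym/umu].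
Qed.

(** The right side does not involve [C]: it is the dual value common to all copulas. *)
Lemma integral_sum_copula (g : R -> R) (M : R) (mu : probability R R)
    (C : probability (R * R)%type R) :
  uniform01 mu -> copula C -> measurable_fun setT g ->
  (forall x, `|g x| <= M) ->
  (\int[C]_(p in unit_square) (g p.1 + g p.2)%:E =
   \int[mu]_x (g x)%:E + \int[mu]_x (g x)%:E)%E.
Proof.
move=> umu cC mg gM; have [C1 C2] := cC.
have mS := measurable_unit_square.
have m1 := @measurable_fst _ _ R R; have m2 := @measurable_snd _ _ R R.
have int1 : C.-integrable unit_square (EFin \o (g \o fst)).
  apply: (@bounded_integrable _ _ _ _ _ M) => //; last by move=> x; exact: gM.
  by apply: measurable_funTS; exact: measurableT_comp.
have int2 : C.-integrable unit_square (EFin \o (g \o snd)).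
  apply: (@bounded_integrable _ _ _ _ _ M) => //; last by move=> x; exact: gM.
  by apply: measurable_funTS; exact: measurableT_comp.
transitivity (\int[C]_(p in unit_square)
    ((EFin \o (g \o fst)) \+ (EFin \o (g \o snd))) p)%E; first by [].
rewrite integralD_EFin//; congr (_ + _)%E.
- exact: (integral_marginal cC m1 C1 umu mg gM).
- exact: (integral_marginal cC m2 C2 umu mg gM).
Qed.

End transport.

(** * The potential rescaled to the unit interval *)

Section unit_potential.
Context {R : realType}.
Context (beta : R) (betaP : beta_equation beta).

(** Cut off outside [0, 1] because the affine piece is unbounded on the line, while integrability is
    derived from a global bound. *)
Definition unit_potential (x : R) : R :=
  if 0 <= x <= 1 then potential (pi * beta) (pi * x) else 0.

Let pi0 : 0 < pi :> R. Proof. exact: pi_gt0. Qed.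
Let b0pi : 0 < pi * beta < pi. Proof. by have /beta_equationE[] := betaP. Qed.
Let rootb : angle_fun (pi * beta) = 0.
Proof. by have /beta_equationE[] := betaP. Qed.

Lemma measurable_sin_fun d (T : measurableType d) (f : T -> R) :
  measurable_fun setT f -> measurable_fun setT (fun x => sin (f x)).
Proof.
move=> mf; apply: (measurableT_comp _ mf).
by apply: continuous_measurable_fun; exact: continuous_sin.
Qed.

Lemma measurable_potential (b : R) : measurable_fun setT (potential b).
Proof.
apply: measurable_fun_ifT.
- exact: measurable_fun_ltr.
- apply: measurable_funD => //; apply: measurable_funM => //.
  exact: measurable_funB.
- apply: measurable_funM => //; apply: measurable_sin_fun.
  exact: measurable_funM.
Qed.

Lemma measurable_unit_potential : measurable_fun setT unit_potential.
Proof.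
apply: measurable_fun_ifT => //.
- by apply: measurable_and; exact: measurable_fun_ler.
- apply: (measurableT_comp (measurable_potential _)); exact: measurable_funM.
Qed.

Lemma unit_potential_bounded x : `|unit_potential x| <= pi + 1.
Proof.
rewrite /unit_potential; case: ifPn => [/andP[x0 x1]|_]; last first.
  by rewrite normr0; move: pi0; lra.
have px0 : 0 <= pi * x by rewrite mulr_ge0// ltW.
have pxpi : pi * x <= pi by rewrite ler_piMr// ltW.
have /andP[b0 bpi] := b0pi.
rewrite /potential; case: ifP => _.
  apply: (le_trans (ler_normD _ _)); apply: lerD.
    rewrite normrM; apply: (@le_trans _ _ (1 * pi)); last by rewrite mul1r.
    apply: ler_pM => //; first exact: cos_max.
    by rewrite ler_norml; apply/andP; split; lra.
  have := sin_max (pi * beta).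
  rewrite normrM [`|2^-1|]ger0_norm ?invr_ge0// => h.
  by lra.
have := sin_max (2 * (pi * x)).
rewrite normrM [`|2^-1|]ger0_norm ?invr_ge0// => h.
by move: pi0; lra.
Qed.

Lemma unit_potential_ge (p : R * R) : unit_square p ->
  sin (pi * (p.1 + p.2)) <= unit_potential p.1 + unit_potential p.2.
Proof.
move=> [/=]; rewrite !in_itv/= /unit_potential => x01 y01.
rewrite x01 y01 mulrDr.
have pi01 (z : R) : 0 <= z <= 1 -> 0 <= pi * z <= pi.
  move=> /andP[z0 z1]; apply/andP; split.
    by apply: mulr_ge0 => //; apply: ltW.
  by rewrite ler_piMr// ltW.
exact: (potential_ge b0pi rootb (pi01 _ x01) (pi01 _ y01)).
Qed.

(** Complementary slackness: below beta both sides are sin (pi beta), and from beta on each point is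
    paired with itself. *)
Lemma unit_potential_Gamma x : 0 <= x <= 1 ->
  unit_potential x + unit_potential (Gamma beta x) =
  sin (pi * (x + Gamma beta x)).
Proof.
have [/andP[b0 b1] _] := betaP.
move=> x01; have /andP[x0 x1] := x01; rewrite /unit_potential x01 /Gamma.
case: ltP => xb.
  rewrite ifT; last by apply/andP; split; lra.
  rewrite mulrBr (potential_reflect rootb); first by congr sin; ring.
  by apply/andP; split; [rewrite mulr_ge0// ltW|rewrite ltr_pM2l].
by rewrite x01 potential_refl -?mulrDr// ler_pM2l.
Qed.

End unit_potential.

(** * Optimality of the law on the graph of [Gamma] *)

Section optimality.
Context {R : realType}.

Lemma integral_distribution_unit_square d (T : measurableType d)
    (P : probability T R) (X : {mfun T >-> (R * R)%type})
    (h : R * R -> R) (M : R) :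
  measurable_fun setT h -> (forall p, `|h p| <= M) ->
  (\int[distribution P X]_(p in unit_square) (h p)%:E =
   \int[P]_(t in X @^-1` unit_square) (h (X t))%:E)%E.
Proof.
move=> mh hM.
have mS := @measurable_unit_square R.
have mXS : measurable (X @^-1` unit_square).
  by rewrite -[Y in measurable Y]setTI; exact: measurable_funPT.
rewrite (@integral_pushforward _ _ _ _ _ X _ P unit_square (EFin \o h))//.
- exact/measurable_EFinP.
- apply: (@bounded_integrable _ _ _ _ _ (h \o X) M) => //.
    by apply: measurable_funTS; exact: measurableT_comp.
  by move=> t; exact: hM.
Qed.

Lemma copula_Gamma_pair (beta : R) d (T : measurableType d)
    (P : probability T R) (U : {RV P >-> R}) : 0 < beta < 1 ->
  uniform01 (distribution P U) -> copula (distribution P (Gamma_pair beta U)).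
Proof.
move=> b01 uU; split=> A mA; first exact: uU.
rewrite -(uniform_prob_Gamma b01 mA); apply: uU.
by rewrite -[X in measurable X]setTI; exact: measurable_Gamma.
Qed.

Lemma Gamma_pair_maximizes (beta : R) d (T : measurableType d)
    (P : probability T R) (U : {RV P >-> R}) : beta_equation beta ->
  uniform01 (distribution P U) ->
  maximizes sin_integral copula (distribution P (Gamma_pair beta U)).
Proof.
move=> betaP uU; have [b01 _] := betaP.
have cG := copula_Gamma_pair b01 uU.
split=> // C cC.
pose g := unit_potential beta.
have mg := measurable_unit_potential beta.
have gM := unit_potential_bounded betaP.
have mS := @measurable_unit_square R.
have ms : measurable_fun setT (fun p : R * R => sin (pi * (p.1 + p.2))).
  apply: measurable_sin_fun; apply: measurable_funM => //.
  exact: measurable_funD.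
have mgg : measurable_fun setT (fun p : R * R => g p.1 + g p.2).
  by apply: measurable_funD; exact: measurableT_comp.
have ggM (p : R * R) : `|g p.1 + g p.2| <= (pi + 1) + (pi + 1).
  by apply: (le_trans (ler_normD _ _)); apply: lerD; exact: gM.
rewrite /sin_integral.
(* Weak duality: the potentials dominate the sine pointwise on the square. *)
apply: (@le_trans _ _ (\int[C]_(p in unit_square) (g p.1 + g p.2)%:E)%E).
  apply: le_integral => //.
  - apply: (@bounded_integrable _ _ _ C unit_square _ 1) => //.
      exact: measurable_funTS.
    by move=> p; exact: sin_max.
  - apply: (@bounded_integrable _ _ _ C unit_square _ (pi + 1 + (pi + 1))) => //.
    exact: measurable_funTS.
  - by move=> p; rewrite inE => /(unit_potential_ge betaP); rewrite lee_fin.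
(* The integral of the potentials is the same for [C] and for the law of the pair. *)
rewrite (integral_sum_copula uU cC mg gM) -(integral_sum_copula uU cG mg gM).
rewrite (integral_distribution_unit_square P _ mgg ggM).
rewrite (integral_distribution_unit_square P _ ms (fun p => sin_max _)).
rewrite le_eqVlt; apply/orP; left; apply/eqP.
(* On the preimage of the square [U t] lies in [0, 1], and there the integrands coincide. *)
apply: eq_integral => t; rewrite inE => -[/= U01 _].
by rewrite unit_potential_Gamma//; move: U01; rewrite in_itv.
Qed.

End optimality.

Theorem corollary1 (R : realType) :
  (exists! beta : R, beta_equation beta) /\
  forall beta : R, beta_equation beta ->
    `|beta - beta_approx| < 2 / 10 ^+ 16 /\
    forall (d : measure_display) (T : measurableType d) (P : probability T R)
      (U : {RV P >-> R}),
      uniform01 (distribution P U) ->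
      maximizes sin_integral copula (distribution P (Gamma_pair beta U)).
Proof.
split=> [|beta betaP]; first exact: beta_equation_unique.
split=> [|d T P U uU]; first exact: beta_equation_approx.
exact: Gamma_pair_maximizes.
Qed.
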